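(* Let $G$ be the group of all (orientation-preserving) affine transformations of a line, represented as $$G=\left\{\begin{pmatrix} a&b\\0&1\end{pmatrix}:\ a>0,\ b\in\mathbb{R}\right\},$$ with Lie algebra $\mathfrak g=T_eG=\left\{\begin{pmatrix}\xi_1&\xi_2\\0&0\end{pmatrix}:\xi_1,\xi_2\in\mathbb{R}\right\}$, and equip $G$ with the left-invariant metric induced by the inner product $\langle\xi,\eta\rangle=\xi_1\eta_1+\xi_2\eta_2$ on $\mathfrak g$ (so that the inertia operator $A:\mathfrak g\to\mathfrak g^*$ is the identity when $\mathfrak g^*$ is identified with $\mathfrak g$ through this inner product). Then the Euler--Arnold equation for $G$, $$\frac{dM_c}{dt}=\{A^{-1}M_c,M_c\},\qquad M_c(t)\in\mathfrak g^*,$$ is equivalent (by an invertible linear change of coordinates) to the system $$\dot x=-xy,\qquad \dot y=x^2 .$$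
   Context: For a Lie group $G$ with Lie algebra $\mathfrak g$ and dual $\mathfrak g^*$, with pairing $(\cdot,\cdot)$ between $\mathfrak g^*$ and $\mathfrak g$: $Ad_g:\mathfrak g\to\mathfrak g$ is the adjoint representation (for matrix groups $Ad_g\eta=g\eta g^{-1}$), and $ad_\xi\eta=\frac{d}{dt}\big|_{t=0}Ad_{e^{t\xi}}\eta=[\xi,\eta]$. The dual operators are defined by $(Ad_g^*\zeta,\eta)=(\zeta,Ad_g\eta)$ and $ad^*_\xi=\frac{d}{dt}\big|_{t=0}Ad^*_{e^{t\xi}}$. The bracket $\{\cdot,\cdot\}:\mathfrak g\times\mathfrak g^*\to\mathfrak g^*$ is $\{\xi,\zeta\}=ad_\xi^*\zeta$, i.e. $(\{\xi,\zeta\},\eta)=(\zeta,[\xi,\eta])$ for $\xi,\eta\in\mathfrak g$, $\zeta\in\mathfrak g^*$. The inertia operator $A:\mathfrak g\to\mathfrak g^*$ is a symmetric positive definite linear operator defining the inner product $\langle\xi,\eta\rangle=(A\xi,\eta)$ on $\mathfrak g$, extended to a left-invariant Riemannian metric on $G$. For a geodesic $g(t)$ of this metric, $M_c=A\,L_{g^{-1}*}\dot g\in\mathfrak g^*$ is the angular momentum in the body ($L_{g^{-1}*}$ is the differential of left translation by $g^{-1}$), and the Euler--Arnold equation is the displayed ordinary differential equation for $M_c$. *)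

(* Defs.v *)
From HB Require Import structures.
From mathcomp Require Import all_boot all_order all_algebra.
From mathcomp Require Import all_classical all_reals all_analysis.
From mathcomp Require Import ring.

Set Implicit Arguments.
Unset Strict Implicit.
Unset Printing Implicit Defensive.

Import Order.TTheory GRing.Theory Num.Theory.
Import numFieldNormedType.Exports.

Local Open Scope classical_set_scope.
Local Open Scope ring_scope.

(* A vectType carries no canonical norm: curves in a finite-dimensional space
   are differentiated in the coordinates of a basis, the choice of which is
   immaterial. *)
Section VectDerivative.
Context {R : realType} {V : vectType R}.

Definition vcoord : V -> 'rV[R]_(\dim {:V}) := passmx.rVof (vbasis {:V}).

Definition is_vderive (f : R -> V) (t : R) (v : V) : Prop :=
  is_derive t 1 (vcoord \o f) (vcoord v).

Definition vderive (f : R -> V) (t : R) : V :=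
  passmx.vecof (vbasis {:V}) ('D_1 (vcoord \o f) t).

End VectDerivative.

Section MatrixGroup.
Context {R : realType} {n : nat}.
Implicit Types (G : set 'M[R]_n.+1) (h X Y : 'M[R]_n.+1).

Definition expm X : 'M[R]_n.+1 :=
  lim (series (fun k => (k`!%:R)^-1 *: X ^+ k) @ \oo).

Definition tangent_space G h : set 'M[R]_n.+1 :=
  [set X | exists2 gamma : R -> 'M[R]_n.+1,
     (forall t, G (gamma t)) /\ gamma 0 = h & is_derive (0 : R) 1 gamma X].

(* The tangent space at the identity, packaged as a vector space; the default
   value 0 is only taken when that set is not a linear subspace. *)
Definition lie_algebra G : {vspace 'M[R]_n.+1} :=
  xget 0%VS [set g : {vspace 'M[R]_n.+1} |
               forall X, X \in g <-> tangent_space G 1 X].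

Definition lie G : vectType R := subvs_of (lie_algebra G).

Definition lie_dual G : vectType R := 'Hom(lie G, R^o).

(* [vsproj] only restores the type: it is the identity on the Lie algebra,
   which is stable under conjugation by G. *)
Definition Ad G h : 'End(lie G) :=
  linfun (fun eta : lie G => vsproj (lie_algebra G) (h * vsval eta * h^-1)).

Definition Ad_star G h : 'End(lie_dual G) :=
  linfun (fun zeta : lie_dual G => (zeta \o Ad G h)%VF : lie_dual G).

Definition ad_star G (xi : lie G) : 'End(lie_dual G) :=
  vderive (fun t : R => Ad_star G (expm (t *: vsval xi))) 0.

Definition bracket G (xi : lie G) (zeta : lie_dual G) : lie_dual G :=
  ad_star xi zeta.

(* [rho h u v] is the value at h of the metric on the tangent vectors u, v. *)
Definition left_invariant (ip : 'M[R]_n.+1 -> 'M[R]_n.+1 -> R) :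
    'M[R]_n.+1 -> 'M[R]_n.+1 -> 'M[R]_n.+1 -> R :=
  fun h u v => ip (h^-1 * u) (h^-1 * v).

Definition inertia G (rho : 'M[R]_n.+1 -> 'M[R]_n.+1 -> 'M[R]_n.+1 -> R) :
    'Hom(lie G, lie_dual G) :=
  linfun (fun xi : lie G =>
    linfun (fun eta : lie G => rho 1 (vsval xi) (vsval eta) : R^o) : lie_dual G).

Definition euler_arnold G rho (J : set R) (M : R -> lie_dual G) : Prop :=
  forall t, J t -> is_vderive M t (bracket ((inertia G rho)^-1%VF (M t)) (M t)).

End MatrixGroup.

Section AffineGroup.
Context {R : realType}.

Definition mx2 (a b c d : R) : 'M[R]_2 :=
  \matrix_(i < 2, j < 2) (nth [::] [:: [:: a; b]; [:: c; d]] i)`_j.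

Definition aff_group : set 'M[R]_2 :=
  [set h | exists a b : R, 0 < a /\ h = mx2 a b 0 1].

Definition aff_ip (xi eta : 'M[R]_2) : R :=
  xi 0 0 * eta 0 0 + xi 0 1 * eta 0 1.

End AffineGroup.

Arguments aff_group : clear implicits.

(* [lie_algebra] does not fall back on its default value for the affine group. *)
Section AffineLieAlgebra.
Context {R : realType}.

Lemma is_derive_mxP m n (M : R -> 'M[R]_(m, n)) (t : R) (N : 'M[R]_(m, n)) :
  is_derive t 1 M N <-> forall i j, is_derive t 1 (fun s => M s i j) (N i j).
Proof.
split.
- case=> dM eM i j; split; first exact: (derivable_mxP _ _ _).1 dM i j.
  by rewrite -eM derive_mx// mxE.
- move=> H; have dM : derivable M t 1.
    by apply/derivable_mxP => i j; case: (H i j).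
  split=> //; rewrite derive_mx//; apply/matrixP => i j; rewrite mxE.
  by case: (H i j).
Qed.

Lemma mx2P (X Y : 'M[R]_2) : X 0 0 = Y 0 0 -> X 0 1 = Y 0 1 -> X 1 0 = Y 1 0 ->
  X 1 1 = Y 1 1 -> X = Y.
Proof.
have E : forall k : 'I_2, k = 0 \/ k = 1.
  by case=> [[|[|//]] p]; [left|right]; apply: val_inj.
move=> h1 h2 h3 h4; apply/matrixP => i j.
by case: (E i) => ->; case: (E j) => ->.
Qed.

Lemma tangent_aff (X : 'M[R]_2) :
  tangent_space (aff_group R) 1 X <-> X 1 0 = 0 /\ X 1 1 = 0.
Proof.
split.
- case=> g [Gg g0] /is_derive_mxP dg.
  have e1 (d : 'I_2) t : g t 1 d = (nth [::] [:: [:: 0; 0]; [:: 0; 1]] 1)`_d :> R.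
    have [a [b [_ ->]]] := Gg t; rewrite mxE.
    by case: d => [[|[|//]] p].
  have c (d : 'I_2) : X 1 d = 0.
    have := dg 1 d.
    rewrite (_ : (fun s => g s 1 d) = cst ((nth [::] [:: [:: 0; 0]; [:: 0; 1]] 1)`_d)); last first.
      by apply/funext => s; rewrite e1.
    by case=> _ <-; rewrite derive_cst.
  by split; apply: c.
- case=> X10 X11.
  exists (fun t => mx2 (expR (t * X 0 0)) (t * X 0 1) 0 1).
    split; first by move=> t; exists (expR (t * X 0 0)), (t * X 0 1); rewrite expR_gt0.
    by apply: mx2P; rewrite !mxE /= ?mul0r ?expR0.
  apply/is_derive_mxP => i j.
  have E : forall k : 'I_2, k = 0 \/ k = 1.
    by case=> [[|[|//]] p]; [left|right]; apply: val_inj.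
  case: (E i) => ->; case: (E j) => ->.
  + rewrite (_ : (fun s : R => _) = (fun s => expR (s * X 0 0))); last by apply/funext=> s; rewrite mxE.
    apply: is_derive_eq.
    rewrite mul0r expR0; rewrite ?/GRing.scale /=; ring.
  + rewrite (_ : (fun s : R => _) = (fun s => (s * X 0 1))); last by apply/funext=> s; rewrite mxE.
    apply: is_derive_eq; rewrite ?/GRing.scale /=; ring.
  + rewrite (_ : (fun s : R => _) = cst 0) ?X10; last by apply/funext=> s; rewrite mxE.
    exact: is_derive_cst.
  + rewrite (_ : (fun s : R => _) = cst 1) ?X11; last by apply/funext=> s; rewrite mxE.
    exact: is_derive_cst.
Qed.

Lemma mem_lie_aff_tangent (X : 'M[R]_2) :
  X \in lie_algebra (aff_group R) <-> tangent_space (aff_group R) 1 X.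
Proof.
rewrite /lie_algebra; case: xgetP => [g _ /(_ X) //|].
move=> /(_ <<[:: mx2 1 0 0 0; mx2 0 1 0 0]>>%VS) /= []Y.
rewrite tangent_aff; rewrite span_cons span_seq1; split.
- case/memv_addP => u /vlineP [a ->] [v /vlineP[b ->] ->].
  by rewrite !mxE /= !mulr0 addr0.
- move=> [h1 h2]; apply/memv_addP; exists (Y 0 0 *: mx2 1 0 0 0).
    by apply/vlineP; exists (Y 0 0).
  exists (Y 0 1 *: mx2 0 1 0 0); first by apply/vlineP; exists (Y 0 1).
  by apply: mx2P; rewrite !mxE /= ?mulr0 ?mulr1 ?addr0 ?add0r.
Qed.

Lemma mem_lie_aff (X : 'M[R]_2) :
  X \in lie_algebra (aff_group R) <-> exists x y, X = mx2 x y 0 0.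
Proof.
rewrite mem_lie_aff_tangent tangent_aff; split=> [[a b]|[x [y ->]]]; last by rewrite !mxE.
by exists (X 0 0), (X 0 1); apply: mx2P; rewrite !mxE.
Qed.

End AffineLieAlgebra.

Definition quadratic_system {R : realType} (J : set R) (x y : R -> R) : Prop :=
  forall t, J t ->
    is_derive t 1 x (- x t * y t) /\ is_derive t 1 y (x t ^+ 2).

(* Main.v *)
Require Import Defs.
From HB Require Import structures.
From mathcomp Require Import all_boot all_order all_algebra.
From mathcomp Require Import all_classical all_reals all_analysis.
From mathcomp Require Import ring.

Set Implicit Arguments.
Unset Strict Implicit.
Unset Printing Implicit Defensive.

Import Order.TTheory GRing.Theory Num.Theory.
Import numFieldNormedType.Exports.

Local Open Scope classical_set_scope.
Local Open Scope ring_scope.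

(** Write e1, e2 for the matrices with a single 1 at position (0, 0), resp.
    (0, 1), of the first row.  They span the Lie algebra, and
    [xi, eta] = (xi1 * eta2 - xi2 * eta1) e2, so that
    {xi, zeta} = (- zeta2 * xi2, zeta2 * xi1) in the dual coordinates
    zeta1 = zeta e1, zeta2 = zeta e2 ([bracketE]).  The metric makes (e1, e2)
    orthonormal, hence the angular velocity A^-1 zeta has the coordinates
    (zeta1, zeta2) of zeta itself ([inertia_inv]), and the Euler-Arnold
    equation reads zeta1' = - zeta2 ^ 2, zeta2' = zeta1 * zeta2.  With
    x = zeta2 and y = - zeta1 this is x' = - x y, y' = x ^ 2.

    The work lies in computing the bracket from its definition as a derivative
    of Ad^* along a matrix exponential.  Every X in the Lie algebra satisfies
    X Y = X1 Y for all Y in it; in particular X^2 = X1 X, so that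
    exp (t X) = 1 + phi(t) X with
    phi(t) = (exp (t X1) - 1) / X1, to be read as t when X1 = 0
    ([expm_quasi_idempotent]).  Conjugation by exp (t X) is then exactly
    1 + phi(t) ad X ([Ad_expm]): the whole curve t |-> Ad^* (exp (t X)) lies on
    an affine line of endomorphisms, and its derivative at 0 is the direction
    of that line because phi'(0) = 1.

    Derivatives in an abstract finite-dimensional space are taken in some
    basis; [is_vderive_rV] lets the final comparison be made in the
    coordinates (x, y) instead. *)

(** * Derivatives in finite-dimensional spaces, and a matrix exponential *)

Lemma linfunE (R : realType) (aT rT : vectType R) (f : aT -> rT) :
  linear f -> linfun f =1 f.
Proof.
move=> lf.
pose g : {linear aT -> rT} := HB.pack f (GRing.isLinear.Build _ _ _ _ f lf).
by move=> x; rewrite -[f]/(g : aT -> rT) lfunE.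
Qed.

Section Calculus.
Context {R : realType}.

(** Each coordinate of [L u] is a fixed linear combination of those of [u]. *)
Lemma is_derive_linear_rV m n (L : 'rV[R]_m -> 'rV[R]_n)
    (g : R -> 'rV[R]_m) (t : R) (v : 'rV[R]_m) :
  linear L -> is_derive t 1 g v -> is_derive t 1 (L \o g) (L v).
Proof.
move=> linL /is_derive_mxP dg; apply/is_derive_mxP => i j.
pose L' : {linear _ -> _} := HB.pack L (GRing.isLinear.Build _ _ _ _ L linL).
have LE u : L u i j = \sum_k lin1_mx L k j * u 0 k.
  rewrite -[L]/(L' : _ -> _) -mul_rV_lin1 ord1 mxE.
  by apply: eq_bigr => k _; rewrite mulrC.
rewrite LE (_ : (fun s => _) = \sum_k (fun s => lin1_mx L k j * g s 0 k)).
  by apply: is_derive_sum => k; have := dg 0 k; apply: is_deriveZ.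
by apply/funext => s; rewrite fct_sumE /= LE.
Qed.

(** Differentiability of a curve does not depend on the linear coordinates in
    which it is read: two coordinate systems differ by a linear map between
    spaces of row vectors. *)
Lemma is_vderive_rV (V : vectType R) n (Phi : {linear V -> 'rV[R]_n})
    (M : R -> V) (t : R) (v : V) : bijective Phi ->
  is_vderive M t v <-> is_derive t 1 (Phi \o M) (Phi v).
Proof.
case=> Psi PhiK PsiK; rewrite /is_vderive /vcoord.
have basisV := vbasisP {:V}.
have linPsi : linear Psi by move=> a u w; apply: (canLR PhiK); rewrite linearP !PsiK.
split=> [|dM].
  rewrite -{2}(passmx.rVofK basisV v).
  have -> : Phi \o M =
      (Phi \o passmx.vecof (vbasis {:V})) \o (passmx.rVof (vbasis {:V}) \o M).
    by apply/funext => s /=; rewrite passmx.rVofK.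
  apply: is_derive_linear_rV => a u w /=.
  by rewrite passmx.vecof_linear linearP.
rewrite -(PhiK v).
have -> : passmx.rVof (vbasis {:V}) \o M =
    (passmx.rVof (vbasis {:V}) \o Psi) \o (Phi \o M).
  by apply/funext => s /=; rewrite PhiK.
apply: is_derive_linear_rV dM => a u w /=.
by rewrite linPsi passmx.rVof_linear.
Qed.

Lemma vderive_affine (V : vectType R) (phi : R -> R) (a b : V) (t : R) :
  is_derive t 1 phi 1 -> vderive (fun s => a + phi s *: b) t = b.
Proof.
move=> dphi; rewrite /vderive.
rewrite (_ : vcoord \o _ = fun s => vcoord a + phi s *: vcoord b); last first.
  apply/funext => s /=.
  by rewrite addrC /vcoord passmx.rVof_linear addrC.
suff /(@derive_val _ _ _ _ _ _ _) -> : is_derive t 1 (fun s => vcoord a + phi s *: vcoord b) (vcoord b).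
  exact/passmx.rVofK/vbasisP.
apply/is_derive_mxP => i j.
rewrite (_ : (fun s => _) = fun s => vcoord a i j + phi s * vcoord b i j); last first.
  by apply/funext => s; rewrite !mxE.
by apply: is_derive_eq; rewrite /GRing.scale/=; ring.
Qed.

(** The function t |-> sum over k >= 1 of t^k x^(k-1) / k!, in closed form. *)
Definition expm1_over (x t : R) : R :=
  if x == 0 then t else x^-1 * (expR (t * x) - 1).

(** The left-hand side is the factor by which 1 + expm1_over x t *: X
    multiplies an eigenvector of X for the eigenvalue x; it does not vanish. *)
Lemma mulr_expm1_over x t : 1 + x * expm1_over x t = expR (t * x).
Proof.
rewrite /expm1_over; case: eqP => [->|/eqP x0]; first by rewrite mulr0 expR0 mul0r addr0.
by rewrite mulrA mulfV// mul1r; ring.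
Qed.

Lemma is_derive_expm1_over x : is_derive (0 : R) 1 (expm1_over x) 1.
Proof.
rewrite /expm1_over; case: eqP => [_|/eqP x0]; first exact: is_derive_id.
apply: is_derive_eq; rewrite mul0r expR0 /GRing.scale/=.
by field.
Qed.

(** Here X^(k+1) = x^k X, so that all terms of the exponential series but the
    first are multiples of X, and the matrix series reduces to a scalar one. *)
Lemma expm_quasi_idempotent n (X : 'M[R]_n.+1) (x t : R) : X * X = x *: X ->
  expm (t *: X) = 1 + expm1_over x t *: X.
Proof.
move=> XX; rewrite /expm; set S := series _.
suff cS : S @ \oo --> (1 + expm1_over x t *: X : 'M[R]_n.+1).
  by apply: cvg_lim cS; exact: norm_hausdorff.
have XS k : X ^+ k.+1 = x ^+ k *: X.
  elim: k => [|k IH]; first by rewrite expr0 scale1r expr1.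
  by rewrite exprS IH -scalerAr XX scalerA exprSr.
pose c (k : nat) : R := \sum_(0 <= i < k) t ^+ i.+1 * x ^+ i / (i.+1)`!%:R.
(* The shift isolates the term 1 of index 0, the only one not a multiple of X. *)
rewrite -cvg_shiftS /=.
have -> : (fun k => S k.+1) =
    fun k => 1 + c k *: X.
  apply/funext => k; rewrite /S /series /= big_nat_recl//= expr0 fact0 invr1 scale1r.
  congr (_ + _); rewrite /c scaler_suml; apply: eq_bigr => i _.
  by rewrite exprZn XS !scalerA; congr (_ *: _); ring.
apply: cvgD; [by apply: cvg_cst|].
apply: cvgZr_tmp; rewrite /expm1_over; case: eqP => [x0|/eqP x0].
  (* For x = 0 only the term of index 0 of c survives. *)
  rewrite -cvg_shiftS /= (_ : (fun _ => _) = cst t); first exact: cvg_cst.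
  apply/funext => k; rewrite /c big_nat_recl// big1 => [|i _].
    by rewrite addr0 expr0 expr1 mulr1 divr1.
  by rewrite x0 expr0n /= mulr0 mul0r.
have -> : c = fun k => x^-1 * (series (exp_coeff (t * x)) k.+1 - 1).
  apply/funext => k; rewrite /series /= big_nat_recl// /exp_coeff /= expr0 divr1.
  rewrite addrAC subrr add0r /c mulr_sumr; apply: eq_bigr => i _.
  by rewrite [in RHS]exprMn [x ^+ i.+1]exprS; field; rewrite x0 pnatr_eq0 -lt0n fact_gt0.
apply: cvgM; [exact: cvg_cst|apply: cvgB; [|exact: cvg_cst]].
by rewrite (cvg_shiftS (series (exp_coeff (t * x)))); exact: is_cvg_series_exp_coeff.
Qed.

End Calculus.

(** * The Lie algebra of the affine group and its coadjoint bracket *)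

Section AffineLie.
Context {R : realType}.
Local Notation g := (lie (aff_group R)).
Local Notation g' := (lie_dual (aff_group R)).

Lemma vsval_lie (xi : g) :
  vsval xi = mx2 (vsval xi 0 0) (vsval xi 0 1) 0 0.
Proof.
have /mem_lie_aff [x [y ->]] := subvsP xi.
by apply: mx2P; rewrite !mxE.
Qed.

(** The second rows vanish, so that only the entry (0, 0) of the left factor
    enters the product.  All commutators below are computed from this. *)
Lemma mul_lie (xi eta : g) :
  vsval xi * vsval eta = vsval xi 0 0 *: vsval eta.
Proof.
rewrite [vsval xi]vsval_lie [vsval eta]vsval_lie; apply: mx2P;
  rewrite !mxE !big_ord_recl big_ord0 !mxE /=; ring.
Qed.

Definition lie_e1 : g := vsproj _ (mx2 1 0 0 0).
Definition lie_e2 : g := vsproj _ (mx2 0 1 0 0).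

Lemma vsval_e1 : vsval lie_e1 = mx2 1 0 0 0.
Proof. by rewrite vsprojK//; apply/mem_lie_aff; exists 1, 0. Qed.

Lemma vsval_e2 : vsval lie_e2 = mx2 0 1 0 0.
Proof. by rewrite vsprojK//; apply/mem_lie_aff; exists 0, 1. Qed.

Lemma lie_decomp (xi : g) :
  xi = vsval xi 0 0 *: lie_e1 + vsval xi 0 1 *: lie_e2.
Proof.
apply: subvs_inj; rewrite linearD !linearZ/= vsval_e1 vsval_e2.
by rewrite {1}vsval_lie; apply: mx2P; rewrite !mxE /=; ring.
Qed.

Lemma lie_dual_decomp (zeta : g') (eta : g) :
  zeta eta = vsval eta 0 0 * zeta lie_e1 + vsval eta 0 1 * zeta lie_e2.
Proof. by rewrite {1}(lie_decomp eta) linearD !linearZ. Qed.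

(** By [mul_lie] the commutator of two elements is this combination of them; in
    this form it lies in the Lie algebra by construction. *)
Definition ad (xi : g) : 'End(g) :=
  linfun (fun eta : g => vsval xi 0 0 *: eta - vsval eta 0 0 *: xi).

Lemma adE (xi eta : g) :
  ad xi eta = vsval xi 0 0 *: eta - vsval eta 0 0 *: xi.
Proof.
rewrite /ad linfunE// => a u v; rewrite [vsval (_ + _)]linearP /= !mxE.
rewrite scalerDr scalerBr !scalerA scalerDl opprD addrACA.
by rewrite [_ * a]mulrC.
Qed.

Lemma vsval_ad (xi eta : g) :
  vsval (ad xi eta) = vsval xi * vsval eta - vsval eta * vsval xi.
Proof.
rewrite adE linearB !linearZ /= !mul_lie.
by rewrite scalerN.
Qed.

(** With p the value of the scalar function, h = 1 + p xi.  Moving h across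
    eta produces the commutator, h * eta = (eta + p ad xi eta) * h, without a
    term in p^2: the entry (0, 0) of a commutator is 0, so that
    ad xi eta * xi = 0 by [mul_lie]. *)
Lemma conj_expm (xi eta : g) (t : R) :
  let h := expm (t *: vsval xi) in
  h * vsval eta * h^-1 =
  vsval (eta + expm1_over (vsval xi 0 0) t *: ad xi eta).
Proof.
move=> h.
set x := vsval xi 0 0; set p := expm1_over x t.
have hE : h = 1 + p *: vsval xi by apply: expm_quasi_idempotent; exact: mul_lie.
have xp0 : 1 + x * p != 0 by rewrite mulr_expm1_over expR_eq0.
(* 1 + q xi is the inverse of h: q solves p + q + x p q = 0. *)
pose q := - p / (1 + x * p).
have hV a b : a + b + x * a * b = 0 ->
    (1 + a *: vsval xi) * (1 + b *: vsval xi) = 1.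
  move=> ab; rewrite mulrDl mul1r mulrDr mulr1 -scalerAl -scalerAr mul_lie.
  rewrite -addrA !scalerA -!scalerDl -/x.
  rewrite [X in _ + X *: _](_ : _ = a + b + x * a * b); last by ring.
  by rewrite ab scale0r addr0.
have hU : h \is a GRing.unit.
  apply/unitrP; exists (1 + q *: vsval xi); rewrite hE.
  by split; apply: hV; rewrite /q; field.
suff -> : h * vsval eta = vsval (eta + p *: ad xi eta) * h by rewrite mulrK.
have adX : vsval (ad xi eta) * vsval xi = 0.
  rewrite mul_lie vsval_ad !mul_lie !mxE mulrC subrr; exact: scale0r.
rewrite hE linearD linearZ /= mulrDr mulr1 mulrDl mul1r -addrA -scalerAl.
congr (_ + _); rewrite [X in _ + X]mulrDl -[X in _ + (_ + X)]scalerAl -!scalerAr adX.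
by rewrite !scaler0 addr0 -scalerDr vsval_ad subrK.
Qed.

(** The dependence on t is confined to a scalar factor. *)
Lemma Ad_expm (xi : g) (t : R) :
  Ad (aff_group R) (expm (t *: vsval xi)) =
  (\1 + expm1_over (vsval xi 0 0) t *: ad xi)%VF.
Proof.
apply/lfunP => eta; rewrite /Ad.
rewrite (_ : (fun _ => _) = (\1 + expm1_over (vsval xi 0 0) t *: ad xi)%VF).
  by rewrite lfunE.
apply/funext => {}eta; rewrite conj_expm vsvalK.
by rewrite add_lfunE scale_lfunE id_lfunE.
Qed.

(** By [Ad_expm], Ad^* (exp (t xi)) moves along a line whose direction is
    precomposition with [ad xi]. *)
Lemma bracket_comp_ad (xi : g) (zeta : g') : bracket xi zeta = (zeta \o ad xi)%VF.
Proof.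
pose E : 'End(g') := linfun (fun z : g' => (z \o ad xi)%VF : g').
have EE z : E z = (z \o ad xi)%VF.
  rewrite /E linfunE// => a u v.
  by rewrite comp_lfunDl -comp_lfunZl.
rewrite /bracket -EE; suff -> : ad_star xi = E by [].
rewrite /ad_star; pose phi := expm1_over (vsval xi 0 0).
have -> : (fun t => Ad_star (aff_group R) (expm (t *: vsval xi))) =
    (fun t => \1 + phi t *: E)%VF.
  apply/funext => t; apply/lfunP => z; rewrite /Ad_star Ad_expm linfunE => [|a u v].
    rewrite add_lfunE scale_lfunE id_lfunE EE.
    by rewrite comp_lfunDr comp_lfun1r comp_lfunZr.
  by rewrite comp_lfunDl -comp_lfunZl.
exact/vderive_affine/is_derive_expm1_over.
Qed.

Lemma bracketE (xi : g) (zeta : g') (eta : g) :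
  bracket xi zeta eta =
  (vsval xi 0 0 * vsval eta 0 1 - vsval xi 0 1 * vsval eta 0 0) * zeta lie_e2.
Proof.
rewrite bracket_comp_ad comp_lfunE lie_dual_decomp vsval_ad !mul_lie !mxE.
by ring.
Qed.

Lemma inertiaE (xi eta : g) :
  inertia (aff_group R) (left_invariant aff_ip) xi eta =
  aff_ip (vsval xi) (vsval eta).
Proof.
pose ip (x e : g) : R^o := left_invariant aff_ip 1 (vsval x) (vsval e).
have ipE x e : ip x e = aff_ip (vsval x) (vsval e).
  by rewrite /ip /left_invariant invr1 !mul1r.
have lin2 x : linear (ip x).
  by move=> a u v; rewrite !ipE /aff_ip linearP /= !mxE /GRing.scale /=; ring.
rewrite /inertia linfunE ?(linfunE (lin2 xi))// => a u v.
apply/lfunP => e; rewrite add_lfunE scale_lfunE.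
rewrite !(linfunE (lin2 _)) !ipE /aff_ip linearP /= !mxE /GRing.scale /=; ring.
Qed.

(** As (e1, e2) is orthonormal, the vector on the right has inertia zeta; that
    is enough since the inertia operator is injective. *)
Lemma inertia_inv (zeta : g') :
  ((inertia (aff_group R) (left_invariant aff_ip))^-1)%VF zeta =
  zeta lie_e1 *: lie_e1 + zeta lie_e2 *: lie_e2.
Proof.
set A := inertia _ _.
have A_inj : lker A == 0%VS.
  apply/lker0P => u v Auv; rewrite (lie_decomp u) (lie_decomp v).
  have := inertiaE u lie_e1; have := inertiaE u lie_e2.
  rewrite -/A Auv !inertiaE /aff_ip vsval_e1 vsval_e2 !mxE /=.
  by rewrite !mulr0 !mulr1 !addr0 !add0r => -> ->.
rewrite -[RHS](lker0_lfunK A_inj); congr (_ _).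
apply/lfunP => eta; rewrite inertiaE lie_dual_decomp /aff_ip.
rewrite linearD !linearZ /= vsval_e1 vsval_e2 !mxE /=; ring.
Qed.

(** * The equation in the coordinates (x, y) *)

(** The sign of y accounts for the equation zeta1' = - zeta2 ^ 2. *)
Definition euler_coord (zeta : g') : 'rV[R]_2 :=
  \row_j (if j == 0 then zeta lie_e2 else - zeta lie_e1).

Lemma euler_coord_linear : linear euler_coord.
Proof.
move=> a u v; apply/rowP => j; rewrite !mxE.
by case: ifP => _; rewrite add_lfunE scale_lfunE /GRing.scale /=; ring.
Qed.

HB.instance Definition _ :=
  GRing.isLinear.Build R g' 'rV[R]_2 *:%R euler_coord euler_coord_linear.

Lemma euler_coord_bij : bijective euler_coord.
Proof.
pose B (r : 'rV[R]_2) (eta : g) : R^o := - vsval eta 0 0 * r 0 1 + vsval eta 0 1 * r 0 0.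
have linB r : linear (B r).
  by move=> a u v; rewrite /B linearP /= !mxE /GRing.scale/=; ring.
exists (fun r => linfun (B r)) => [zeta|r].
  apply/lfunP => eta; rewrite linfunE// /B !mxE /= [RHS]lie_dual_decomp; ring.
apply/rowP => j; rewrite !mxE !linfunE// /B vsval_e1 vsval_e2 !mxE /=.
case: j => [[|[|//]] p] /=.
  by rewrite oppr0 mul0r add0r mul1r; congr (r _ _); apply: val_inj.
by rewrite mul0r addr0 mulN1r opprK; congr (r _ _); apply: val_inj.
Qed.

Lemma euler_coord_bracket (zeta : g') :
  let x := euler_coord zeta 0 0 in let y := euler_coord zeta 0 1 in
  euler_coord (bracket
    (((inertia (aff_group R) (left_invariant aff_ip))^-1)%VF zeta) zeta) =
  \row_j (if j == 0 then - x * y else x ^+ 2).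
Proof.
have vsvalD a b : vsval (a *: lie_e1 + b *: lie_e2) = mx2 a b 0 0.
  by rewrite linearD !linearZ /= vsval_e1 vsval_e2; apply: mx2P; rewrite !mxE /=; ring.
apply/rowP => j; rewrite inertia_inv !mxE /= !bracketE vsvalD vsval_e1 vsval_e2.
by rewrite !mxE /=; case: ifP => _; ring.
Qed.

End AffineLie.

Theorem theorem6p3 (R : realType) :
  exists Phi : {linear lie_dual (aff_group R) -> 'rV[R]_2},
    bijective Phi /\
    forall (J : set R) (M : R -> lie_dual (aff_group R)),
      is_interval J -> open J ->
      euler_arnold (left_invariant aff_ip) J M <->
      quadratic_system J (fun t => Phi (M t) 0 0) (fun t => Phi (M t) 0 1).
Proof.
exists euler_coord; split; first exact: euler_coord_bij.
move=> J M _ _.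
suff E t : is_vderive M t (bracket
      (((inertia (aff_group R) (left_invariant aff_ip))^-1)%VF (M t)) (M t)) <->
    is_derive t 1 (fun s => euler_coord (M s) 0 0)
      (- euler_coord (M t) 0 0 * euler_coord (M t) 0 1) /\
    is_derive t 1 (fun s => euler_coord (M s) 0 1) (euler_coord (M t) 0 0 ^+ 2).
  by split=> H t Jt; apply/E; exact: H.
rewrite (is_vderive_rV _ _ _ euler_coord_bij).
rewrite [X in is_derive _ _ _ X](euler_coord_bracket (M t)) is_derive_mxP.
split=> [H|[H0 H1] i j].
  by split; [have := H 0 0|have := H 0 1]; rewrite [X in is_derive _ _ _ X]mxE.
rewrite (ord1 i) [X in is_derive _ _ _ X]mxE; case: j => [[|[|//]] p] /=.
  by rewrite (_ : Ordinal p = 0) //; exact: val_inj.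
by rewrite (_ : Ordinal p = 1) //; exact: val_inj.
Qed.
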